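(* Let $N$ be a positive integer and $a\in\{1,2,\ldots,N\}$. For formal variables $u,v,w$, $$\sum_{k\geq n+s,\ n\geq s\geq 1}G^\star_{0,N,a}(k,n,s)\,u^{k-n-s}v^{n-s}w^{s-1}=\frac{1}{a(a-u-v)+uv-w}\;{}_3F_2\!\left(\begin{matrix}\frac aN,\ \frac{a-u}{N},\ 1\\ \alpha^\star,\ \beta^\star\end{matrix};1\right),$$ where $\alpha^\star,\beta^\star$ are determined by $\alpha^\star+\beta^\star=\frac1N(2a+2N-u-v)$ and $\alpha^\star\beta^\star=\frac1{N^2}\bigl((a+N)(a+N-u-v)+uv-w\bigr)$.
   Context: An index is a finite sequence $\mathbf{k}=(k_1,\ldots,k_n)$ of positive integers; its weight is $k_1+\cdots+k_n$, its depth is $n$, and its height is the number of $j$ with $k_j\geq 2$. It is admissible if $k_1>1$. For an admissible index, $$t^\star_{N,a}(k_1,\ldots,k_n)=\sum_{m_1\geq\cdots\geq m_n>0,\ m_i\equiv a\ (\mathrm{mod}\ N)}\frac{1}{m_1^{k_1}\cdots m_n^{k_n}}.$$ $I_0(k,n,s)$ is the set of admissible indices of weight $k$, depth $n$ and height $s$, and $G^\star_{0,N,a}(k,n,s)=\sum_{\mathbf{k}\in I_0(k,n,s)}t^\star_{N,a}(\mathbf{k})$. The generalized hypergeometric function is $${}_{m+1}F_m\!\left(\begin{matrix}b_1,\ldots,b_{m+1}\\ c_1,\ldots,c_m\end{matrix};z\right)=\sum_{j=0}^\infty\frac{(b_1)_j\cdots(b_{m+1})_j}{(c_1)_j\cdots(c_m)_j}\frac{z^j}{j!},$$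 with $(b)_0=1$, $(b)_j=b(b+1)\cdots(b+j-1)$. The identity is one of formal power series in $u,v,w$: each term of the hypergeometric series (which depends on $\alpha^\star,\beta^\star$ only through $\alpha^\star+\beta^\star$ and $\alpha^\star\beta^\star$) is expanded as a power series in $u,v,w$ and the series is summed coefficientwise. *)

(* Defs.v *)
From HB Require Import structures.
From mathcomp Require Import all_boot all_order all_algebra.
From mathcomp Require Import all_classical all_reals all_analysis.

Set Implicit Arguments.
Unset Strict Implicit.
Unset Printing Implicit Defensive.

Import Order.TTheory GRing.Theory Num.Theory.
Import numFieldNormedType.Exports.

Local Open Scope classical_set_scope.
Local Open Scope ring_scope.

(* Formal power series in one variable over A.  A record rather than an alias
   of [nat -> A], because MathComp-Analysis equips the latter with the pointwise
   ring structure. *)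
Record fps (A : Type) := Fps { fps_coef :> nat -> A }.

HB.instance Definition _ (A : Type) := gen_eqMixin (fps A).
HB.instance Definition _ (A : Type) := gen_choiceMixin (fps A).

Lemma fpsP (A : Type) (f g : fps A) : (forall n, f n = g n) <-> f = g.
Proof.
by split=> [|->//]; case: f g => f [g] /= /funext ->.
Qed.

Section FpsZmodule.
Variable A : zmodType.

Definition fps_zero : fps A := Fps (fun _ => 0).
Definition fps_opp (f : fps A) : fps A := Fps (fun n => - f n).
Definition fps_add (f g : fps A) : fps A := Fps (fun n => f n + g n).

Fact fps_addA : associative fps_add.
Proof. by move=> f g h; apply/fpsP => n; exact: addrA. Qed.
Fact fps_addC : commutative fps_add.
Proof. by move=> f g; apply/fpsP => n; exact: addrC. Qed.
Fact fps_add0 : left_id fps_zero fps_add.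
Proof. by move=> f; apply/fpsP => n; exact: add0r. Qed.
Fact fps_addN : left_inverse fps_zero fps_opp fps_add.
Proof. by move=> f; apply/fpsP => n; exact: addNr. Qed.

HB.instance Definition _ :=
  GRing.isZmodule.Build (fps A) fps_addA fps_addC fps_add0 fps_addN.

Lemma fps_coef0 n : (0 : fps A) n = 0. Proof. by []. Qed.
Lemma fps_coefN (f : fps A) n : (- f) n = - f n. Proof. by []. Qed.
Lemma fps_coefD (f g : fps A) n : (f + g) n = f n + g n. Proof. by []. Qed.
Lemma fps_coefB (f g : fps A) n : (f - g) n = f n - g n. Proof. by []. Qed.

Lemma fps_coef_sum (I : Type) (r : seq I) (P : pred I) (F : I -> fps A) n :
  (\sum_(i <- r | P i) F i) n = \sum_(i <- r | P i) F i n.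
Proof. by elim/big_rec2: _ => // i x y _ <-. Qed.

End FpsZmodule.

Section FpsRing.
Variable A : comNzRingType.
Implicit Types f g h : fps A.

Definition fps_const (c : A) : fps A := Fps (fun n => if n == 0%N then c else 0).
Definition fps_var : fps A := Fps (fun n => (n == 1%N)%:R).
Definition fps_mul f g : fps A := Fps (fun n => \sum_(i < n.+1) f i * g (n - i)%N).

Fact fps_mul_rev f g n : fps_mul f g n = \sum_(i < n.+1) f (n - i)%N * g i.
Proof.
rewrite /= (reindex_inj rev_ord_inj) /=.
by apply: eq_bigr => i _; rewrite (sub_ordK i).
Qed.

Fact fps_mulC : commutative fps_mul.
Proof.
move=> f g; apply/fpsP => n; rewrite fps_mul_rev.
by apply: eq_bigr => i _; rewrite mulrC.
Qed.

Fact fps_mulA : associative fps_mul.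
Proof.
move=> f g h; apply/fpsP => n; rewrite [RHS]fps_mul_rev.
change (fps_mul f (fps_mul g h) n)
  with (\sum_(i < n.+1) f i * fps_mul g h (n - i)%N).
pose coef3 j k := f j * (g (n - j - k)%N * h k).
transitivity (\sum_(j < n.+1) \sum_(k < n.+1 | (k <= n - j)%N) coef3 j k).
  apply: eq_bigr => j _; rewrite fps_mul_rev.
  by rewrite big_distrr /= (big_ord_narrow_leq (leq_subr _ _)).
rewrite (exchange_big_dep predT) //=; apply: eq_bigr => k _.
transitivity (\sum_(j < n.+1 | (j <= n - k)%N) coef3 j k).
  apply: eq_bigl => j; rewrite -ltnS -(ltnS j) -!subSn ?leq_ord //.
  by rewrite -subn_gt0 -(subn_gt0 j) -!subnDA addnC.
rewrite (big_ord_narrow_leq (leq_subr _ _)) big_distrl /=.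
by apply: eq_bigr => j _; rewrite /coef3 -!subnDA addnC mulrA.
Qed.

Fact fps_mul1 : left_id (fps_const 1) fps_mul.
Proof.
move=> f; apply/fpsP => n /=.
by rewrite big_ord_recl /= mul1r subn0 big1 ?addr0 // => i _; rewrite mul0r.
Qed.

Fact fps_mulDl : left_distributive fps_mul +%R.
Proof.
move=> f g h; apply/fpsP => n /=; rewrite -big_split /=.
by apply: eq_bigr => i _; rewrite mulrDl.
Qed.

Fact fps_one_neq0 : fps_const 1 != 0.
Proof. by apply/eqP => /fpsP/(_ 0%N)/eqP; rewrite /= oner_eq0. Qed.

HB.instance Definition _ := GRing.Zmodule_isComNzRing.Build (fps A)
  fps_mulA fps_mulC fps_mul1 fps_mulDl fps_one_neq0.

Lemma fps_coef1 n : (1 : fps A) n = (n == 0%N)%:R.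
Proof. by case: n. Qed.

Lemma fps_coefM f g n : (f * g) n = \sum_(i < n.+1) f i * g (n - i)%N.
Proof. by []. Qed.

Lemma fps_coef0M f g : (f * g) 0%N = f 0%N * g 0%N.
Proof. by rewrite fps_coefM big_ord1. Qed.

Lemma fps_coefCM (c : A) f n : (fps_const c * f) n = c * f n.
Proof.
rewrite fps_coefM big_ord_recl /= subn0 big1 ?addr0 // => i _.
by rewrite mul0r.
Qed.

Lemma fps_coefX_lt f m n : f 0%N = 0 -> (n < m)%N -> (f ^+ m) n = 0.
Proof.
move=> f0; elim: m n => // m IHm n ltnm.
rewrite exprS fps_coefM big1 // => -[[|i] /= ltin] _; first by rewrite f0 mul0r.
rewrite IHm ?mulr0 //; apply: (leq_trans _ (ltnSE ltnm)).
by rewrite ltn_subrL /= (leq_ltn_trans _ (ltnSE ltin)).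
Qed.

End FpsRing.

Section FpsUnitRing.
Variable A : comUnitRingType.
Implicit Types f g : fps A.

Definition fps_unit : pred (fps A) := fun f => f 0%N \is a GRing.unit.

(* f^-1 = c^-1 (1 + h + h^2 + ...) with c the constant coefficient of f and
   h = 1 - c^-1 f; as h has no constant coefficient, h^m does not contribute to
   the n-th coefficient for n < m. *)
Definition fps_inv f : fps A :=
  if f 0%N \is a GRing.unit then
    Fps (fun n =>
      (f 0%N)^-1 * (\sum_(m < n.+1) (1 - fps_const (f 0%N)^-1 * f) ^+ m) n)
  else f.

Fact fps_mulVf : {in fps_unit, left_inverse 1 fps_inv *%R}.
Proof.
move=> f; rewrite unfold_in /fps_unit /fps_inv => Uf; rewrite Uf.
set c := f 0%N in Uf *; set h := 1 - fps_const c^-1 * f.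
have h0 : h 0%N = 0 by rewrite /h fps_coefB fps_coefCM fps_coef1 mulVr ?subrr.
apply/fpsP => n; rewrite fps_coefM.
transitivity (((\sum_(m < n.+1) h ^+ m) * (1 - h)) n).
  rewrite fps_coefM; apply: eq_bigr => i _; have ltin := ltn_ord i.
  have -> : 1 - h = fps_const c^-1 * f by rewrite /h subKr.
  rewrite fps_coefCM mulrA [_ * c^-1]mulrC.
  congr (_ * _ * _); rewrite !fps_coef_sum.
  rewrite (big_ord_widen n.+1 (fun m => (h ^+ m) i)) // big_mkcond /=.
  apply: eq_bigr => m _; case: ltnP => // ltim.
  by rewrite fps_coefX_lt.
have -> : (\sum_(m < n.+1) h ^+ m) * (1 - h) = 1 - h ^+ n.+1.
  rewrite -[in RHS](expr1n _ n.+1) subrXX mulrC; congr (_ * _).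
  by apply: eq_bigr => i _; rewrite expr1n mul1r.
by rewrite fps_coefB (fps_coefX_lt h0 (ltnSn n)) subr0.
Qed.

Fact fps_unitPl f g : g * f = 1 -> fps_unit f.
Proof.
move=> /fpsP/(_ 0%N); rewrite fps_coef0M fps_coef1 => gf1.
by apply/unitrPr; exists (g 0%N); rewrite mulrC.
Qed.

Fact fps_inv_out : {in [predC fps_unit], fps_inv =1 id}.
Proof. by move=> f; rewrite inE /= unfold_in /fps_unit /fps_inv => /negbTE ->. Qed.

HB.instance Definition _ := GRing.ComNzRing_hasMulInverse.Build (fps A)
  fps_mulVf fps_unitPl fps_inv_out.

Lemma fps_unitE f : (f \is a GRing.unit) = (f 0%N \is a GRing.unit).
Proof. by []. Qed.

End FpsUnitRing.

(* R[[u,v,w]] as R[[u]][[v]][[w]]. *)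
Definition fps3 (R : realType) : comUnitRingType := fps (fps (fps R)).

Section Fps3.
Variable R : realType.

Definition coef3 (f : fps3 R) (i j l : nat) : R :=
  (f : fps (fps (fps R))) l j i.

Definition mkfps3 (c : nat -> nat -> nat -> R) : fps3 R :=
  Fps (fun l => Fps (fun j => Fps (fun i => c i j l))).

Definition var_u : fps3 R := fps_const (fps_const (fps_var R)).
Definition var_v : fps3 R := fps_const (fps_var (fps R)).
Definition var_w : fps3 R := fps_var (fps (fps R)).

Definition is_coefwise_sum (T : nat -> fps3 R) (S : fps3 R) : Prop :=
  forall i j l : nat, series (fun m => coef3 (T m) i j l) @ \oo --> coef3 S i j l.

End Fps3.

Section Hypergeometric.
Variable A : comUnitRingType.

Definition pochhammer (b : A) (j : nat) : A := \prod_(i < j) (b + i%:R).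

Definition hypergeom_term (m : nat) (b : m.+1.-tuple A) (c : m.-tuple A)
    (z : A) (j : nat) : A :=
  (\prod_(i < m.+1) pochhammer (tnth b i) j) /
  (\prod_(i < m) pochhammer (tnth c i) j) * (z ^+ j / (j`!)%:R).

End Hypergeometric.

(* H is the value of the hypergeometric series with parameters b, c in an
   extension phi : R[[u,v,w]] -> A: every term lies in (the image of)
   R[[u,v,w]], and H is the coefficientwise sum of these terms.  Parameters in
   an extension are needed because the lower parameters of the theorem are the
   roots of a quadratic polynomial that has no root in R[[u,v,w]]. *)
Definition is_hypergeom (R : realType) (A : comUnitRingType)
    (phi : {rmorphism fps3 R -> A}) (m : nat)
    (b : m.+1.-tuple A) (c : m.-tuple A) (z : A) (H : fps3 R) : Prop :=
  exists T : nat -> fps3 R,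
    (forall j, phi (T j) = hypergeom_term b c z j) /\ is_coefwise_sum T H.

Definition is_index (k : seq nat) : bool := all (fun x => 0 < x)%N k.
Definition weight (k : seq nat) : nat := sumn k.
Definition depth (k : seq nat) : nat := size k.
Definition height (k : seq nat) : nat := count (fun x => 2 <= x)%N k.
Definition admissible (k : seq nat) : bool := is_index k && (1 < head 0%N k)%N.

Definition I0 (k n s : nat) : set (seq nat) :=
  [set kk | [/\ admissible kk, weight kk = k, depth kk = n & height kk = s]].

Definition tstar_dom (N a n : nat) : set (seq nat) :=
  [set m | [/\ size m = n, sorted geq m &
              forall x, x \in m -> (0 < x)%N /\ x = a %[mod N]]].

(* The sum has nonnegative terms and is finite for admissible k. *)
Definition tstar (R : realType) (N a : nat) (k : seq nat) : R :=
  fine (\esum_(m in tstar_dom N a (size k))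
          ((\prod_(i < size k) (nth 0%N m i)%:R ^- nth 0%N k i : R)%:E)).

Definition G0star (R : realType) (N a k n s : nat) : R :=
  \sum_(kk \in I0 k n s) tstar R N a kk.

(* The term of (k, n, s) sits at the exponents i = k - n - s, j = n - s,
   l = s - 1; this is a bijection between the triples with k >= n + s,
   n >= s >= 1 and all triples of natural numbers (i, j, l). *)
Definition G0star_gf (R : realType) (N a : nat) : fps3 R :=
  mkfps3 (fun i j l =>
    let s := l.+1 in let n := (j + s)%N in let k := (i + n + s)%N in
    G0star R N a k n s).

(* Main.v *)
Require Import Defs.
From HB Require Import structures.
From mathcomp Require Import all_boot all_order all_algebra.
From mathcomp Require Import all_classical all_reals all_analysis.
From mathcomp Require Import ring lra zify.

Set Implicit Arguments.
Unset Strict Implicit.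
Unset Printing Implicit Defensive.

Import Order.TTheory GRing.Theory Num.Theory.
Import numFieldNormedType.Exports.
Local Open Scope classical_set_scope.
Local Open Scope ring_scope.

(* Call the integers m_q = a + q N the progression.  A part k attached to the
   summation variable m contributes m ^ -k times v if k = 1 and u ^ r w if
   k = r + 2, hence summing over the possible parts gives
   x = v / m + w / (m (m - u)), and summing over all finite repetitions of m
   gives 1 / (1 - x) = m (m - u) / D(m) with D(m) = (m - u) (m - v) - w.
   Therefore the star sums over all indices with variables among
   m_0, ..., m_q have the generating function
   prod_(i <= q) m_i (m_i - u) / D(m_i).  An admissible index with largest
   variable m_q has a first part contributing w / (m_q (m_q - u)), so after
   division by w these terms add up to
   prod_(i < q) m_i (m_i - u) / prod_(i <= q) D(m_i), which is D(a)^-1 times the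
   q-th term of the hypergeometric series. *)

(** * Trivariate power series *)

Lemma cvgn_sum (R : realType) (I : Type) (r : seq I) (P : pred I)
    (f : I -> nat -> R) (l : I -> R) :
  (forall i, P i -> f i @ \oo --> l i) ->
  (fun n => \sum_(i <- r | P i) f i n) @ \oo --> \sum_(i <- r | P i) l i.
Proof. by move=> fl; apply: cvg_big => // i; exact: add_continuous. Qed.

Lemma fps_coefXM (A : comNzRingType) (f : fps A) n :
  (fps_var A * f) n = if n is n'.+1 then f n' else 0.
Proof.
rewrite fps_coefM; case: n => [|n]; first by rewrite big_ord1 /= mul0r.
rewrite big_ord_recl /= mul0r add0r big_ord_recl /= mul1r subSS subn0.
by rewrite big1 ?addr0 // => i _; rewrite mul0r.
Qed.

Section Coef3.
Variable R : realType.
Implicit Types f g : fps3 R.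

Lemma fps3P f g : (forall i j l, coef3 f i j l = coef3 g i j l) -> f = g.
Proof.
by move=> fg; apply/fpsP => l; apply/fpsP => j; apply/fpsP => i; exact: fg.
Qed.

Lemma coef3D f g i j l : coef3 (f + g) i j l = coef3 f i j l + coef3 g i j l.
Proof. by []. Qed.

Lemma coef3B f g i j l : coef3 (f - g) i j l = coef3 f i j l - coef3 g i j l.
Proof. by []. Qed.

Lemma coef3_natM n f i j l : coef3 (n%:R * f) i j l = n%:R * coef3 f i j l.
Proof.
rewrite !mulr_natl; elim: n => [|n IHn]; first by rewrite !mulr0n.
by rewrite !mulrS coef3D IHn.
Qed.

Lemma coef3_uM f i j l :
  coef3 (var_u R * f) i j l = if i is i'.+1 then coef3 f i' j l else 0.
Proof. by rewrite /coef3 !fps_coefCM fps_coefXM. Qed.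

Lemma coef3_vM f i j l :
  coef3 (var_v R * f) i j l = if j is j'.+1 then coef3 f i j' l else 0.
Proof. by rewrite /coef3 fps_coefCM fps_coefXM; case: j. Qed.

Lemma coef3_wM f i j l :
  coef3 (var_w R * f) i j l = if l is l'.+1 then coef3 f i j l' else 0.
Proof. by rewrite /coef3 fps_coefXM; case: l. Qed.

Lemma coef3M f g i j l :
  coef3 (f * g) i j l =
  \sum_(z < l.+1) \sum_(y < j.+1) \sum_(x < i.+1)
     coef3 f x y z * coef3 g (i - x) (j - y) (l - z).
Proof.
rewrite /coef3 fps_coefM !fps_coef_sum; apply: eq_bigr => z _.
by rewrite fps_coefM fps_coef_sum; apply: eq_bigr => y _; rewrite fps_coefM.
Qed.

Lemma coef3_1 i j l :
  coef3 (1 : fps3 R) i j l = ((i == 0) && (j == 0) && (l == 0))%N%:R.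
Proof.
rewrite /coef3 fps_coef1; case: l => [|l]; last by rewrite andbF.
by rewrite fps_coef1; case: j => [|j]; rewrite ?andbF // fps_coef1 !andbT.
Qed.

Lemma fps3_unitE f : (f \is a GRing.unit) = (coef3 f 0 0 0 != 0).
Proof. by rewrite !fps_unitE unitfE. Qed.

(** A coefficient of a product is a finite linear combination of coefficients of [T m], so the limit
    passes through it. *)
Lemma is_coefwise_sumM f (T : nat -> fps3 R) S :
  is_coefwise_sum T S -> is_coefwise_sum (fun m => f * T m) (f * S).
Proof.
move=> TS i j l; rewrite coef3M.
have -> : series (fun m => coef3 (f * T m) i j l) = fun P =>
    \sum_(z < l.+1) \sum_(y < j.+1) \sum_(x < i.+1)
     coef3 f x y z * series (fun m => coef3 (T m) (i - x) (j - y) (l - z)) P.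
  apply/funext => P; rewrite /series /=.
  under eq_bigr do rewrite coef3M.
  rewrite exchange_big; apply: eq_bigr => z _.
  rewrite exchange_big; apply: eq_bigr => y _.
  by rewrite exchange_big; apply: eq_bigr => x _; rewrite mulr_sumr.
do 3![apply: cvgn_sum => ? _].
by apply: cvgM; [exact: cvg_cst|exact: TS].
Qed.

End Coef3.

(** * Generating functions over indices *)

(* Indices with [i = weight - depth - height], [j = depth - height] and
   [l = height], provided that [n = j + l]. *)
Fixpoint indices (n i j l : nat) : seq (seq nat) :=
  if n is n'.+1 then
    (if j is j'.+1 then [seq 1%N :: kk | kk <- indices n' i j' l] else [::]) ++
    (if l is l'.+1 then
       [seq r.+2 :: kk | r <- iota 0 i.+1, kk <- indices n' (i - r) j l']
     else [::])
  else if (i == 0%N) && (j == 0%N) && (l == 0%N) then [:: [::]] else [::].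

Lemma indicesS n i j l : indices n.+1 i j l =
    (if j is j'.+1 then [seq 1%N :: kk | kk <- indices n i j' l] else [::]) ++
    (if l is l'.+1 then
       [seq r.+2 :: kk | r <- iota 0 i.+1, kk <- indices n (i - r) j l']
     else [::]).
Proof. by []. Qed.

Lemma leq_depth_height_weight kk :
  is_index kk -> (depth kk + height kk <= weight kk)%N.
Proof.
elim: kk => //= k kk IHkk /andP[k0 /IHkk].
by rewrite /depth /height /weight /=; case: ltnP; lia.
Qed.

Lemma indicesP n i j l kk :
  (kk \in indices n i j l) =
  [&& is_index kk, weight kk == (i + j + l.*2)%N, depth kk == n,
      (j + l)%N == n & height kk == l].
Proof.
elim: n i j l kk => [|n IHn] i j l kk.
  rewrite /=; case: kk => [|k kk] /=; last first.
    by rewrite !andbF; case: ifP.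
  rewrite addn_eq0 /weight /height /=.
  by case: i => [|i]; case: j => [|j]; case: l => [|l].
rewrite indicesS mem_cat.
case: kk => [|k kk].
  rewrite !andbF; apply/negbTE; rewrite negb_or; apply/andP; split.
    by case: j => // j; apply/mapP => -[].
  by case: l => // l; apply/negP => /allpairsPdep[? [? [_ _ ]]].
case: k => [|[|r]].
- apply/negbTE; rewrite negb_or; apply/andP; split.
    by case: j => // j; apply/mapP => -[].
  by case: l => // l; apply/negP => /allpairsPdep[? [? [_ _ ]]].
- rewrite [X in _ || X](_ : _ = false); last first.
    by apply/negbTE; case: l => // l; apply/negP => /allpairsPdep[? [? [_ _ ]]].
  rewrite orbF; case: j => [|j].
    rewrite in_nil; apply/esym/negbTE; apply/negP.
    move=> /and5P[/= _ _ /eqP s1 /eqP s2 /eqP s3].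
    move: s1 s2 s3; rewrite /depth /height /=.
    have := count_size (fun x => 2 <= x)%N kk; lia.
  rewrite mem_map ?IHn; last by move=> ? ? [].
  rewrite /weight /depth /height /=.
  by congr [&& _, _, _, _ & _]; lia.
- rewrite [X in X || _](_ : _ = false); last first.
    by apply/negbTE; case: j => // j; apply/mapP => -[].
  rewrite orFb; case: l => [|l].
    rewrite in_nil /height /=; apply/esym/negbTE; apply/negP.
    by move=> /and5P[_ _ _ _].
  apply/allpairsPdep/idP => [[r' [kk' [r'i]]]|].
    rewrite IHn => /and5P[h1 /eqP h2 /eqP h3 /eqP h4 /eqP h5] [-> ->].
    move: r'i h2 h3 h4 h5; rewrite mem_iota /weight /depth /height /= => *.
    by apply/and5P; split; [exact: h1|lia..].
  move=> /and5P[h1 /eqP h2 /eqP h3 /eqP h4 /eqP h5].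
  (* Applied to the tail [kk], this bound yields [r <= i], so that [i - r] is not truncated. *)
  have := leq_depth_height_weight (h1 : is_index kk).
  move: h2 h3 h4 h5; rewrite /weight /depth /height /= => h2 h3 h4 h5 le_w.
  exists r, kk; split => //; first by rewrite (mem_iota 0 i.+1); lia.
  by rewrite IHn (h1 : is_index kk) /weight /depth /height; lia.
Qed.

Lemma indices_uniq n i j l : uniq (indices n i j l).
Proof.
elim: n i j l => [|n IHn] i j l; first by rewrite /=; case: ifP.
rewrite indicesS cat_uniq; apply/and3P; split.
- by case: j => // j; rewrite map_inj_uniq // => ? ? [].
- apply/hasPn => kk; case: l => // l /allpairsPdep[r [kk' [_ _ ->]]].
  by case: j => // j; apply/mapP => -[].
- case: l => // l.
  apply: (allpairs_uniq_dep (f := fun r kk => r.+2 :: kk)) => //.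
    exact: (iota_uniq 0 i.+1).
  by move=> [r kk] [r' kk'] _ _ /= [-> ->].
Qed.

Section IndexGeneratingFunctions.
Variable R : realType.
Implicit Types F G : seq nat -> R.

Definition index_gf F : fps3 R :=
  mkfps3 (fun i j l => \sum_(kk <- indices (j + l) i j l) F kk).

(* Divided by [w]: the first entry [r + 2] contributes [u ^ r w]. *)
Definition admissible_gf F : fps3 R :=
  mkfps3 (fun i j l => \sum_(r <- iota 0 i.+1)
    \sum_(kk <- indices (j + l) (i - r) j l) F (r.+2 :: kk)).

Lemma eq_index_gf F G : F =1 G -> index_gf F = index_gf G.
Proof. by move=> FG; apply: fps3P => i j l; apply: eq_bigr. Qed.

Lemma index_gfD F G :
  index_gf (fun kk => F kk + G kk) = index_gf F + index_gf G.
Proof. by apply: fps3P => i j l; exact: big_split. Qed.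

Lemma admissible_gfD F G :
  admissible_gf (fun kk => F kk + G kk) = admissible_gf F + admissible_gf G.
Proof.
apply: fps3P => i j l; rewrite /coef3 /=.
by under eq_bigr do rewrite big_split; rewrite big_split.
Qed.

(** Split by the first entry: there is none, or it is 1 and carries [v], or it is at least 2 and its
    [w] was divided out of [admissible_gf]. *)
Lemma index_gf_rec F : F [::] = 1 ->
  index_gf F = 1 + var_v R * index_gf (fun kk => F (1%N :: kk)) +
    var_w R * admissible_gf F.
Proof.
move=> F1; apply: fps3P => i j l; rewrite !coef3D coef3_1 coef3_vM coef3_wM.
case jl : (j + l)%N => [|n].
  move/eqP: jl; rewrite addn_eq0 => /andP[/eqP-> /eqP->].
  rewrite /coef3 /= !addr0 !andbT.
  by case: i => [|i]; rewrite ?big_nil // big_seq1 F1.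
rewrite -andbA -addn_eq0 jl andbF add0r {1}/coef3 /= jl indicesS big_cat.
congr (_ + _).
  case: j jl => [|j] jl; first by rewrite big_nil.
  by rewrite big_map /coef3 /= (_ : (j + l)%N = n) //; lia.
case: l jl => [|l] jl; first by rewrite big_nil.
by rewrite big_allpairs_dep /coef3 /= (_ : (j + l)%N = n) //; lia.
Qed.

Lemma index_gf_div m F : (0 < m)%N ->
  m%:R * index_gf (fun kk => m%:R^-1 * F kk) = index_gf F.
Proof.
move=> m0; have mR0 : m%:R != 0 :> R by rewrite pnatr_eq0 -lt0n.
apply: fps3P => i j l; rewrite coef3_natM /coef3 /= mulr_sumr.
by apply: eq_bigr => kk _; rewrite mulVKf.
Qed.

Lemma coef3_natBuM m (f : fps3 R) i j l :
  coef3 (m%:R * f - var_u R * f) i j l =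
  m%:R * coef3 f i j l - (if i is i'.+1 then coef3 f i' j l else 0).
Proof.
by rewrite coef3B; congr (_ - _); [exact: coef3_natM|exact: coef3_uM].
Qed.

(** The first entry contributes [u ^ r * m ^- (r + 2)], a geometric series in [r] with sum
    [1 / (m (m - u))]; with denominators cleared, summing it becomes a cancellation of shifted
    coefficients. *)
Lemma admissible_gf_cons m F G : (0 < m)%N ->
  (forall k kk, G (k :: kk) = m%:R ^- k * F kk) ->
  (m%:R * (m%:R - var_u R)) * admissible_gf G = index_gf F.
Proof.
move=> m0 GF; have mR0 : m%:R != 0 :> R by rewrite pnatr_eq0 -lt0n.
have expand (A : comPzRingType) (x u g : A) :
  x * (x - u) * g = x * (x * g) - u * (x * g) by ring.
rewrite expand; apply: fps3P => i j l.
rewrite coef3_natBuM coef3_natM.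
pose X r := \sum_(kk <- indices (j + l) r j l) F kk.
have cX i' : coef3 (admissible_gf G) i' j l =
    \sum_(0 <= r < i'.+1) m%:R ^- r.+2 * X (i' - r)%N.
  rewrite /coef3 /= /index_iota subn0; apply: eq_bigr => r _.
  by rewrite mulr_sumr; apply: eq_bigr => kk _; rewrite GF.
have -> : coef3 (index_gf F) i j l = X i by [].
rewrite cX big_nat_recl // subn0 !mulrDr -addrA.
rewrite [X in X + _](_ : _ = X i); last by field.
(* The terms with [r > 0] cancel against the sum shifted by [u]. *)
rewrite [X in _ + X](_ : _ = 0) ?addr0 //.
case: i => [|i]; first by rewrite big_geq // !mulr0 subr0.
rewrite coef3_natM cX !mulr_sumr -sumrB big1 // => r _.
by rewrite subSS !exprS; field; rewrite expf_neq0.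
Qed.

(** Subtracting the two recursions gives [g - f = v * x + w * y]; multiplying by [m * (m - u)]
    eliminates [x] and [y] in favour of [g]. *)
Lemma index_gf_step_aux (A : comPzRingType) (m u v w x y f g h k c : A) :
  m * x = g -> m * (m - u) * y = g ->
  f = c + v * h + w * k -> g = c + v * (h + x) + w * (k + y) ->
  ((m - u) * (m - v) - w) * g = m * (m - u) * f.
Proof.
move=> xg yg fE gE.
have -> : f = g - v * x - w * y by rewrite fE gE; ring.
have -> : m * (m - u) * (g - v * x - w * y) =
  m * (m - u) * g - v * (m - u) * (m * x) - w * (m * (m - u) * y) by ring.
by rewrite xg yg; ring.
Qed.

Lemma index_gf_step m F G : (0 < m)%N -> F [::] = 1 -> G [::] = 1 ->
  (forall k kk, G (k :: kk) = F (k :: kk) + m%:R ^- k * G kk) ->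
  ((m%:R - var_u R) * (m%:R - var_v R) - var_w R) * index_gf G =
  m%:R * (m%:R - var_u R) * index_gf F.
Proof.
move=> m0 F1 G1 GF.
(* The part of [G] whose first variable is [m]. *)
pose D kk := if kk is k :: kk' then m%:R ^- k * G kk' else 0.
have Dgf : m%:R * (m%:R - var_u R) * admissible_gf D = index_gf G.
  exact: admissible_gf_cons.
have := index_gf_rec G1; have := index_gf_rec F1.
have -> : admissible_gf G = admissible_gf F + admissible_gf D.
  rewrite -admissible_gfD; apply: fps3P => i j l.
  by do 2![apply: eq_bigr => ? _].
have -> : index_gf (fun kk => G (1%N :: kk)) =
    index_gf (fun kk => F (1%N :: kk)) + index_gf (fun kk => m%:R^-1 * G kk).
  by rewrite -index_gfD; apply: eq_index_gf => kk; rewrite GF.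
move: (index_gf_div G m0) Dgf.
move: (index_gf (fun kk => m%:R^-1 * G kk)) (admissible_gf D) => x y.
by move=> xG yG IF_rec IG_rec; exact: (index_gf_step_aux xG yG IF_rec IG_rec).
Qed.

End IndexGeneratingFunctions.

(** * Truncated star sums *)

Lemma esumZl (R : realType) (T : choiceType) (I : set T) (c : R)
    (f : T -> \bar R) : 0 < c -> (forall i, (0 <= f i)%E) ->
  \esum_(i in I) (c%:E * f i)%E = (c%:E * \esum_(i in I) f i)%E.
Proof.
move=> c0 f0; rewrite /esum -ereal_sup_pZl //; congr ereal_sup.
rewrite image_comp; apply: eq_imagel => A [_ AI] /=.
by rewrite ge0_mule_fsumr.
Qed.

Section TruncatedStarSums.
Variables (R : realType) (N a : nat).
Hypotheses (hN : (0 < N)%N) (ha : (1 <= a <= N)%N).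

Definition progression (q : nat) : nat := (a + q * N)%N.

Local Notation prog := progression.

Lemma prog_gt0 q : (0 < prog q)%N.
Proof. by rewrite /progression addn_gt0; case/andP: ha => ->. Qed.

Lemma leq_prog p q : (prog p <= prog q)%N = (p <= q)%N.
Proof. by rewrite /progression leq_add2l leq_pmul2r. Qed.

Lemma ltn_prog p q : (prog p < prog q)%N = (p < q)%N.
Proof. by rewrite /progression ltn_add2l ltn_pmul2r. Qed.

(** As [1 <= a <= N], the least positive member of the residue class is [a]. The case [a = N] is
    separate because there [a] reduces to 0 modulo [N]. *)
Lemma progP x : (0 < x)%N /\ x = a %[mod N] <-> exists q, x = prog q.
Proof.
split=> [[x0 xa]|[q ->]]; last by rewrite prog_gt0 /progression addnC modnMDl.
exists ((x - a) %/ N)%N; rewrite /progression.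
have le_ax : (a <= x)%N.
  case/andP: ha => a0; rewrite leq_eqVlt => /orP[/eqP aN|aN].
    move: xa; rewrite aN modnn => /eqP xN.
    by rewrite dvdn_leq.
  by move: xa; rewrite (modn_small aN) => <-; exact: leq_mod.
rewrite divnK ?subnKC //.
by rewrite -eqn_mod_dvd // xa.
Qed.

(* The star sum over [prog P > m_1 >= ... >= m_n]; as [m_(i+1) <= m_i = prog q]
   means [m_(i+1) < prog q.+1], the bound becomes [q.+1] after an entry. *)
Fixpoint tstar_lt (kk : seq nat) (P : nat) : R :=
  if kk is k :: kk' then
    \sum_(q < P) (prog q)%:R ^- k * tstar_lt kk' q.+1
  else 1.

Lemma tstar_lt_ge0 kk P : 0 <= tstar_lt kk P.
Proof.
elim: kk P => [|k kk IHkk] P //=; apply: sumr_ge0 => q _.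
by rewrite mulr_ge0 ?invr_ge0 ?exprn_ge0.
Qed.

Lemma tstar_ltS k kk P : tstar_lt (k :: kk) P.+1 =
  tstar_lt (k :: kk) P + (prog P)%:R ^- k * tstar_lt kk P.+1.
Proof. exact: big_ord_recr. Qed.

Definition tstar_term (kk m : seq nat) : \bar R :=
  (\prod_(i < size kk) (nth 0%N m i)%:R ^- nth 0%N kk i : R)%:E.

Lemma tstar_term_cons k kk x m :
  tstar_term (k :: kk) (x :: m) = ((x%:R ^- k)%:E * tstar_term kk m)%E.
Proof. by rewrite /tstar_term /= big_ord_recl EFinM. Qed.

Lemma tstar_term_ge0 kk m : (0 <= tstar_term kk m)%E.
Proof. by rewrite lee_fin prodr_ge0 // => i _; rewrite invr_ge0 exprn_ge0. Qed.

(** The sequences are nonincreasing, so a bound on the head bounds every entry. The default head 0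
    keeps the empty sequence in, [prog P] being positive. *)
Definition tstar_dom_lt (n P : nat) : set (seq nat) :=
  tstar_dom N a n `&` [set m | (head 0%N m < prog P)%N].

(** Below a first entry [prog q] the next entry is at most [prog q], that is, less than [prog q.+1].
    Letting [I] vary covers both the truncated sums and the full one. *)
Lemma tstar_dom_cons n (I : set nat) :
  set_bij (I `*`` fun q => tstar_dom_lt n q.+1)
    (tstar_dom N a n.+1 `&` [set m | exists2 q, I q & head 0%N m = prog q])
    (fun x => prog x.1 :: x.2).
Proof.
split.
- move=> [q m] /= [Iq [[sm sorted_m m_prog] lt_m]].
  split; last by exists q.
  split=> /=; first by rewrite sm.
    case: m sm sorted_m m_prog lt_m => //= x m _ -> m_prog; rewrite andbT.
    have [|p ->] := (progP x).1; first by apply: m_prog; rewrite mem_head.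
    by rewrite ltn_prog leq_prog ltnS.
  move=> x; rewrite inE => /predU1P[->|]; last exact: m_prog.
  by apply/progP; exists q.
- move=> [q m] [q' m'] _ _ /= [/eqP]; rewrite eqn_add2l eqn_pmul2r //.
  by move=> /eqP -> ->.
- move=> [|x m] [[//= [sm] sorted_m m_prog] [q Iq /= xq]].
  exists (q, m); last by rewrite /= xq.
  split=> //=; split.
    split=> //; first exact: path_sorted sorted_m.
    by move=> y ym; apply: m_prog; rewrite inE ym orbT.
  case: m sorted_m {sm m_prog} => [|y m] /=; first by rewrite prog_gt0.
  by case/andP => yx _; apply: (leq_ltn_trans yx); rewrite xq ltn_prog.
Qed.

Lemma esum_tstar_cons k kk (I : set nat) :
  (forall P, \esum_(m in tstar_dom_lt (size kk) P) tstar_term kk m =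
             (tstar_lt kk P)%:E) ->
  \esum_(m in tstar_dom N a (size kk).+1 `&`
      [set m | exists2 q, I q & head 0%N m = prog q]) tstar_term (k :: kk) m =
  \esum_(q in I) ((prog q)%:R ^- k * tstar_lt kk q.+1)%:E.
Proof.
move=> kkE; rewrite (reindex_esum _ _ _ _ (tstar_dom_cons _ _)).
rewrite -(@esum_esum _ _ _ _ _
  (fun q m => tstar_term (k :: kk) (prog q :: m))); last first.
  by move=> *; exact: tstar_term_ge0.
apply: eq_esum => q Iq; rewrite EFinM -kkE.
under eq_esum do rewrite tstar_term_cons.
rewrite esumZl ?invr_gt0 ?exprn_gt0 ?ltr0n ?prog_gt0 // => ?.
exact: tstar_term_ge0.
Qed.

Lemma esum_tstar_lt kk P :
  \esum_(m in tstar_dom_lt (size kk) P) tstar_term kk m = (tstar_lt kk P)%:E.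
Proof.
elim: kk P => [|k kk IHkk] P.
  rewrite (_ : tstar_dom_lt _ _ = [set [::]]).
    by rewrite esum_set1 /tstar_term ?big_ord0 // lee_fin.
  apply/seteqP; split=> [m [[/size0nil->]] //|_ ->]; split => //=.
  exact: prog_gt0.
rewrite (_ : tstar_dom_lt _ _ = tstar_dom N a (size kk).+1 `&`
    [set m | exists2 q, `I_P q & head 0%N m = prog q]); last first.
  apply/seteqP; split=> m [dom_m head_m]; split=> //.
    case: m dom_m head_m => [[]//|x m] [_ _ m_prog] /= xP.
    have [|p xp] := (progP x).1; first by apply: m_prog; rewrite mem_head.
    by exists p; rewrite // -ltn_prog -xp.
  by case: head_m => q qP mq; rewrite /= mq ltn_prog.
rewrite esum_tstar_cons // esum_fset //; last first.
  by move=> q _; rewrite lee_fin mulr_ge0 ?tstar_lt_ge0 ?invr_ge0 ?exprn_ge0.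
by rewrite fsumEFin // -fsbig_ord.
Qed.

(** The truncated sums are nondecreasing and bounded, hence converge; they are the partial sums of
    the series over the first variable, so [fine] in [tstar] is applied to a finite value. *)
Lemma tstar_lt_cvg k kk C : (forall P, tstar_lt (k :: kk) P <= C) ->
  tstar_lt (k :: kk) @ \oo --> tstar R N a (k :: kk).
Proof.
move=> ltC; set t := tstar_lt _.
have /cvg_ex[l tl] : cvgn t.
  apply: nondecreasing_is_cvgn; last by exists C => _ [P _ <-].
  apply/nondecreasing_seqP => P; rewrite /t tstar_ltS lerDl.
  by rewrite mulr_ge0 ?tstar_lt_ge0 ?invr_ge0 ?exprn_ge0.
rewrite (_ : tstar R N a (k :: kk) = l) //.
rewrite /tstar -/(tstar_term _ _).
have -> : tstar_dom N a (size (k :: kk)) = tstar_dom N a (size kk).+1 `&`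
    [set m | exists2 q, setT q & head 0%N m = prog q].
  apply/seteqP; split=> m; last by case.
  move=> dom_m; split=> //.
  case: m dom_m => [[]//|x m] [_ _ m_prog] /=.
  have [|p xp] := (progP x).1; first by apply: m_prog; rewrite mem_head.
  by exists p.
rewrite esum_tstar_cons; last exact: esum_tstar_lt.
rewrite -nneseries_esumT; last first.
  by move=> q; rewrite lee_fin mulr_ge0 ?tstar_lt_ge0 ?invr_ge0 ?exprn_ge0.
rewrite (_ : (fun n => _) = EFin \o t); last first.
  by apply/funext => P; rewrite sumEFin big_mkord.
have tlE : EFin \o t @ \oo --> l%:E by apply: cvg_EFin => //; exact: nearW.
by rewrite (cvg_lim _ tlE).
Qed.

(** * Uniform bounds for the truncated sums of admissible indices *)

Lemma prog_inv_telescope q :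
  (prog q)%:R ^- 2 + 2%:R * (prog q.+1)%:R^-1 <= 2%:R * (prog q)%:R^-1 :> R.
Proof.
have q0 : 0 < (prog q)%:R :> R by rewrite ltr0n prog_gt0.
have N1 : 1 <= N%:R :> R by rewrite ler1n.
have q1 : 1 <= (prog q)%:R :> R by rewrite ler1n prog_gt0.
have -> : prog q.+1 = (prog q + N)%N by rewrite /progression mulSn; lia.
rewrite natrD -subr_ge0.
have -> : 2%:R * (prog q)%:R^-1 -
    ((prog q)%:R ^- 2 + 2%:R * ((prog q)%:R + N%:R)^-1) =
    (2%:R * N%:R * (prog q)%:R - (prog q)%:R - N%:R) /
      ((prog q)%:R ^+ 2 * ((prog q)%:R + N%:R)) :> R.
  by field; lra.
apply: divr_ge0; last by rewrite mulr_ge0 ?exprn_ge0 ?addr_ge0.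
(* With [m = prog q], this product and [N, m >= 1] give [2 N m - m - N >= N + m - 2 >= 0]. *)
have : 0 <= (N%:R - 1) * ((prog q)%:R - 1) :> R by rewrite mulr_ge0 ?subr_ge0.
by nra.
Qed.

(* Summation by parts over the first entry: [m^-2 <= 2 (m^-1 - (m + N)^-1)],
   so the sum over the first entry [m >= m'] of [m^-2] is at most [2 / m'],
   which raises the exponent of the next entry [m'] to at least 2. *)
Lemma tstar_lt2_bound kk P : is_index kk ->
  tstar_lt (2%N :: kk) P <= 2%:R ^+ (size kk).+1.
Proof.
elim: kk P => [|k kk IHkk] P /=.
  move=> _; rewrite -/(tstar_lt [:: 2%N] P).
  suff : tstar_lt [:: 2%N] P + 2%:R * (prog P)%:R^-1 <= 2%:R.
    by apply: le_trans; rewrite lerDl mulr_ge0 ?invr_ge0.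
  elim: P => [|P IHP].
    rewrite /= big_ord0 add0r ler_piMr // invf_le1 ?ltr0n ?ler1n ?prog_gt0 //.
  apply: le_trans IHP; rewrite tstar_ltS mulr1 -addrA lerD2l.
  exact: prog_inv_telescope.
case/andP=> k0 kk_index; rewrite -/(tstar_lt [:: 2%N, k & kk] P).
apply: (@le_trans _ _ (2%:R * tstar_lt (2%N :: kk) P)); last first.
  by rewrite exprS ler_wpM2l // IHkk.
(* The added boundary term of the summation by parts makes the bound inductive in [P]: it absorbs
   the next term through the telescoping inequality. *)
suff : tstar_lt [:: 2%N, k & kk] P +
    2%:R * (prog P)%:R^-1 * tstar_lt (k :: kk) P <=
    2%:R * tstar_lt (2%N :: kk) P.
  by apply: le_trans; rewrite lerDl !mulr_ge0 ?invr_ge0 ?tstar_lt_ge0.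
elim: P => [|P IHP]; first by rewrite /= !big_ord0 !mulr0 addr0.
rewrite !(tstar_ltS 2) (tstar_ltS k).
have xk : (prog P)%:R ^- k <= (prog P)%:R ^-1 :> R.
  rewrite lef_pV2 ?posrE ?exprn_gt0 ?ltr0n ?prog_gt0 //.
  by rewrite -{1}(expr1 (prog P)%:R) ler_weXn2l // ler1n prog_gt0.
have := prog_inv_telescope P; move: IHP xk.
have : 0 <= (prog P)%:R^-1 :> R by rewrite invr_ge0.
have := tstar_lt_ge0 kk P.+1; have := tstar_lt_ge0 (k :: kk) P.+1.
rewrite tstar_ltS -[_ ^- 2]exprVn.
set x := (prog P)%:R^-1; set y := (prog P.+1)%:R^-1; set z := _ ^- k.
set W := tstar_lt kk _; set T := tstar_lt (k :: kk) P.
move=> T0 W0 x0 IHP xk xy.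
have h1 : (x ^+ 2 + 2%:R * y) * (T + z * W) <= 2%:R * x * (T + z * W).
  exact: ler_wpM2r.
have h2 : x * (z * W) <= x * (x * W) by rewrite ler_wpM2l // ler_wpM2r.
by move: h1 h2 IHP; rewrite expr2; lra.
Qed.

Lemma tstar_lt_bound k kk P : (1 < k)%N -> is_index kk ->
  tstar_lt (k :: kk) P <= 2%:R ^+ (size kk).+1.
Proof.
move=> k1 /(tstar_lt2_bound P); apply: le_trans.
apply: ler_sum => q _; apply: ler_wpM2r; first exact: tstar_lt_ge0.
rewrite lef_pV2 ?posrE ?exprn_gt0 ?ltr0n ?prog_gt0 //.
by rewrite ler_weXn2l // ler1n prog_gt0.
Qed.

End TruncatedStarSums.

(** * The hypergeometric series *)

(** At exponent [l] the height is [l + 1]: the leading entry supplies the extra unit, as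
    [admissible_gf] omits its [w]. *)
Lemma G0star_gfE (R : realType) (N a : nat) :
  G0star_gf R N a = admissible_gf (tstar R N a).
Proof.
apply: fps3P => i j l; rewrite /coef3 /= /G0star.
pose s := [seq kk <- indices (j + l).+1 i j l.+1 | 1 < head 0 kk]%N.
rewrite (_ : I0 _ _ _ = [set` s]); last first.
  apply/seteqP; split=> kk /=.
    move=> [/andP[kk_index kk1] w_kk d_kk h_kk].
    rewrite mem_filter kk1 indicesP kk_index w_kk d_kk h_kk eqxx.
    by apply/and4P; split=> //; apply/eqP; lia.
  rewrite mem_filter indicesP => /and4P[kk1 kk_index /eqP w_kk].
  move=> /and3P[/eqP d_kk _ /eqP h_kk].
  by split; rewrite ?w_kk ?d_kk ?h_kk ?/admissible ?kk_index //; lia.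
rewrite -fsbig_seq ?filter_uniq ?indices_uniq // big_filter indicesS big_cat.
rewrite big1_seq; last first.
  by case: j {s} => [|j] kk /andP[kk1] // /mapP[kk' _ kkE]; rewrite kkE in kk1.
rewrite [LHS]add0r big_mkcond big_allpairs_dep.
by apply: eq_bigr => r _; apply: eq_bigr.
Qed.

Section StarGeneratingFunctions.
Variables (R : realType) (N a : nat).
Hypotheses (hN : (0 < N)%N) (ha : (1 <= a <= N)%N).

Local Notation prog := (progression N a).
Local Notation tstar_lt := (tstar_lt R N a).

Definition star_denom (m : nat) : fps3 R :=
  (m%:R - var_u R) * (m%:R - var_v R) - var_w R.

Definition star_numer (m : nat) : fps3 R := m%:R * (m%:R - var_u R).

(** The part of the star sum in which the largest variable is exactly [prog P]. *)
Definition star_layer (P : nat) (kk : seq nat) : R :=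
  if kk is k :: kk' then (prog P)%:R ^- k * tstar_lt kk' P.+1 else 0.

Let coef3_0M (f g : fps3 R) :
  coef3 (f * g) 0 0 0 = coef3 f 0 0 0 * coef3 g 0 0 0.
Proof. by rewrite /coef3 !fps_coef0M. Qed.

Let coef3_0nat m : coef3 (m%:R : fps3 R) 0 0 0 = m%:R.
Proof. by rewrite -[m%:R in LHS]mulr1 coef3_natM coef3_1 mulr1. Qed.

Let coef3_0natB m (x : fps3 R) :
  coef3 x 0 0 0 = 0 -> coef3 (m%:R - x) 0 0 0 = m%:R.
Proof. by move=> x0; rewrite coef3B coef3_0nat x0 subr0. Qed.

Lemma unit_nat m : (0 < m)%N -> (m%:R : fps3 R) \is a GRing.unit.
Proof. by move=> m0; rewrite fps3_unitE coef3_0nat pnatr_eq0 -lt0n. Qed.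

Lemma unit_star_denom m : (0 < m)%N -> star_denom m \is a GRing.unit.
Proof.
move=> m0; rewrite fps3_unitE coef3B coef3_0M !coef3_0natB //.
by rewrite [coef3 (var_w R) _ _ _]/= subr0 mulf_neq0 // pnatr_eq0 -lt0n.
Qed.

Lemma unit_star_numer m : (0 < m)%N -> star_numer m \is a GRing.unit.
Proof.
move=> m0; rewrite fps3_unitE coef3_0M coef3_0natB // coef3_0nat.
by rewrite mulf_neq0 // pnatr_eq0 -lt0n.
Qed.

(** For [P = 0] only the empty index contributes; each further value of the progression brings in
    one factor by [index_gf_step]. *)
Lemma index_gf_tstar_lt P :
  (\prod_(i < P) star_denom (prog i)) * index_gf (tstar_lt^~ P) =
  \prod_(i < P) star_numer (prog i).
Proof.
elim: P => [|P IHP].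
  rewrite !big_ord0 mul1r index_gf_rec //.
  rewrite (_ : index_gf _ = 0) ?mulr0 ?addr0; last first.
    by apply: fps3P => i j l; apply: big1 => kk _; rewrite /= big_ord0.
  rewrite (_ : admissible_gf _ = 0) ?mulr0 ?addr0 //.
  by apply: fps3P => i j l; do 2![apply: big1 => ? _]; rewrite /= big_ord0.
rewrite !big_ord_recr -IHP -mulrA.
rewrite [X in _ * X = _](@index_gf_step _ (prog P) (tstar_lt^~ P)) //;
  last first.
- by move=> k kk; exact: tstar_ltS.
- exact: prog_gt0.
by rewrite mulrA mulrAC.
Qed.

(** Removing the first entry leaves star sums with variables up to [prog P], whose last factor
    [star_numer (prog P)] cancels against the sum over that entry. *)
Lemma admissible_gf_star_layer P :
  (\prod_(i < P.+1) star_denom (prog i)) * admissible_gf (star_layer P) =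
  \prod_(i < P) star_numer (prog i).
Proof.
apply: (mulIr (unit_star_numer (prog_gt0 ha P))).
rewrite -mulrA [admissible_gf _ * _]mulrC.
rewrite [X in _ * X = _](@admissible_gf_cons _ _ (tstar_lt^~ P.+1)) //;
  last first.
  exact: prog_gt0.
by rewrite index_gf_tstar_lt big_ord_recr.
Qed.

(** The layers below [P] add up to [tstar_lt], which converges when the first entry is at least 2,
    and each coefficient involves finitely many indices. *)
Lemma star_layer_coefwise_sum :
  is_coefwise_sum (fun P => admissible_gf (star_layer P))
    (admissible_gf (tstar R N a)).
Proof.
move=> i j l.
rewrite (_ : series _ = fun P => coef3 (admissible_gf (tstar_lt^~ P)) i j l).
  apply: cvgn_sum => r _; rewrite /= big_seq.
  under eq_fun do rewrite big_seq.
  apply: cvgn_sum => kk; rewrite indicesP => /andP[kk_index _].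
  by apply: tstar_lt_cvg => // P; exact: tstar_lt_bound.
apply/funext => P; rewrite /series /= /coef3 /= exchange_big.
apply: eq_bigr => r _; rewrite exchange_big; apply: eq_bigr => kk _.
by rewrite big_mkord.
Qed.

End StarGeneratingFunctions.

(** For lower parameters with the prescribed sum and product, the left side is
    [(alpha + i) * (beta + i)]; [n * q = 1] turns the shift by [i] into a shift by [i * n]. *)
Lemma lower_paramsE (B : comPzRingType) (a n q u v w i : B) : n * q = 1 ->
  q ^+ 2 * ((a + n) * (a + n - u - v) + u * v - w) +
    i * (q * (2%:R * a + 2%:R * n - u - v)) + i ^+ 2 =
  q ^+ 2 * ((a + (1 + i) * n - u) * (a + (1 + i) * n - v) - w).
Proof.
move=> nq.
have -> : i ^+ 2 = (i * (n * q)) ^+ 2 by rewrite nq mulr1.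
have -> : i * (q * (2%:R * a + 2%:R * n - u - v)) =
  i * (n * q) * (q * (2%:R * a + 2%:R * n - u - v)) by rewrite nq mulr1.
by ring.
Qed.

Lemma upper_paramsE (B : comPzRingType) (a n q u i : B) : n * q = 1 ->
  (a * q + i) * ((a - u) * q + i) =
  q ^+ 2 * ((a + i * n) * (a + i * n - u)).
Proof.
move=> nq; have -> : a * q + i = q * (a + i * n).
  by rewrite mulrDr mulrCA [q * n]mulrC nq mulr1 mulrC.
have -> : (a - u) * q + i = q * (a + i * n - u).
  rewrite -addrA [i * n - u]addrC addrA.
  by rewrite mulrDr mulrCA [q * n]mulrC nq mulr1 mulrC.
by ring.
Qed.

Lemma pochhammer_rmorph (B C : comUnitRingType) (f : {rmorphism B -> C}) x j :
  pochhammer (f x) j = f (pochhammer x j).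
Proof.
by rewrite rmorph_prod; apply: eq_bigr => i _; rewrite rmorphD rmorph_nat.
Qed.

Lemma pochhammer1 (B : comUnitRingType) j : pochhammer (1 : B) j = (j`!)%:R.
Proof.
elim: j => [|j IHj]; first by rewrite /pochhammer big_ord0.
by rewrite /pochhammer big_ord_recr /= -/(pochhammer 1 j) IHj factS mulnC
  natrM -natr1 addrC.
Qed.

(** Only the products [(alpha + i) * (beta + i)] enter, and these are symmetric, hence images of
    power series. The upper parameter 1 cancels the [j!] of the term. *)
Lemma hypergeom_term32 (R : realType) (A : comUnitRingType)
    (phi : {rmorphism fps3 R -> A}) (x y z s p : fps3 R) (alpha beta : A) j :
  phi s = alpha + beta -> phi p = alpha * beta ->
  z * (\prod_(i < j) (p + i%:R * s + i%:R ^+ 2)) =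
    pochhammer x j * pochhammer y j ->
  \prod_(i < j) (p + i%:R * s + i%:R ^+ 2) \is a GRing.unit ->
  phi z = hypergeom_term [tuple phi x; phi y; 1] [tuple alpha; beta] 1 j.
Proof.
move=> sE pE zE E_unit; rewrite /hypergeom_term.
rewrite !big_ord_recl !big_ord0 !(tnth_nth 0) /= !mulr1.
rewrite pochhammer1 expr1n mul1r.
have -> : pochhammer alpha j * pochhammer beta j =
    phi (\prod_(i < j) (p + i%:R * s + i%:R ^+ 2)).
  rewrite rmorph_prod -big_split; apply: eq_bigr => i _ /=.
  by rewrite !rmorphD rmorphM rmorphXn /= rmorph_nat sE pE; ring.
have fact_unit : (j`!)%:R \is a @GRing.unit A.
  by rewrite -(rmorph_nat phi) rmorph_unit // unit_nat // fact_gt0.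
rewrite !pochhammer_rmorph mulrA -rmorphM -zE rmorphM.
by rewrite mulrAC mulrK // mulrK // rmorph_unit.
Qed.

Theorem theorem2p2 (R : realType) (N a : nat) (hN : (0 < N)%N)
    (ha : (1 <= a <= N)%N)
    (A : comUnitRingType) (phi : {rmorphism fps3 R -> A})
    (phi_inj : injective phi) (alpha beta : A) :
  let u := var_u R in let v := var_v R in let w := var_w R in
  let a' : fps3 R := a%:R in let N' : fps3 R := N%:R in
  alpha + beta = phi (N'^-1 * (2%:R * a' + 2%:R * N' - u - v)) ->
  alpha * beta =
    phi ((N' ^+ 2)^-1 * ((a' + N') * (a' + N' - u - v) + u * v - w)) ->
  exists H : fps3 R,
    is_hypergeom phi [tuple phi (a' / N'); phi ((a' - u) / N'); 1]
      [tuple alpha; beta] 1 H /\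
    G0star_gf R N a = (a' * (a' - u - v) + u * v - w)^-1 * H.
Proof.
move=> u v w a' N' sE pE.
(* The factor [star_denom R a] offsets the prefactor of the identity. *)
pose T j := star_denom R a * admissible_gf (star_layer R N a j).
have Nu : N' \is a GRing.unit by exact: unit_nat.
have NV : N' * N'^-1 = 1 by exact: mulrV.
have D0 : star_denom R a = a' * (a' - u - v) + u * v - w.
  by rewrite /star_denom -/a' -/u -/v -/w; move: u v w a' {sE pE T} => *; ring.
have Du : star_denom R a \is a GRing.unit.
  by apply: unit_star_denom; case/andP: ha.
exists (star_denom R a * G0star_gf R N a); split; last by rewrite -D0 mulKr.
exists T; split; last first.
  rewrite G0star_gfE; apply: is_coefwise_sumM; exact: star_layer_coefwise_sum.
move=> j.
(* The lower parameters involve [a + N], so their factors start at the second member of the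
   progression, hence [i.+1]. *)
have lowerE (i : 'I_j) :
    (N' ^+ 2)^-1 * ((a' + N') * (a' + N' - u - v) + u * v - w) +
    i%:R * (N'^-1 * (2%:R * a' + 2%:R * N' - u - v)) + i%:R ^+ 2 =
    N'^-1 ^+ 2 * star_denom R (progression N a i.+1).
  rewrite -exprVn (lower_paramsE _ _ _ _ _ NV) /star_denom /progression.
  by rewrite natrD natrM -nat1r.
have upperE (i : 'I_j) : (a' / N' + i%:R) * ((a' - u) / N' + i%:R) =
    N'^-1 ^+ 2 * star_numer R (progression N a i).
  by rewrite (upper_paramsE _ _ _ NV) /star_numer /progression natrD natrM.
apply: (hypergeom_term32 (esym sE) (esym pE)).
  have -> : pochhammer (a' / N') j * pochhammer ((a' - u) / N') j =
      \prod_(i < j) N'^-1 ^+ 2 * \prod_(i < j) star_numer R (progression N a i).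
    by rewrite -!big_split; apply: eq_bigr => i _; exact: upperE.
  rewrite (eq_bigr _ (fun i _ => lowerE i)) big_split.
  (* The factor of index 0 in the denominator product is the [star_denom R a] placed in [T j]. *)
  rewrite -(admissible_gf_star_layer R ha) big_ord_recl.
  rewrite [progression N a ord0]addn0 /T.
  by rewrite mulrCA; congr (_ * _); exact: mulrAC.
apply: rpred_prod => i _; rewrite lowerE unitrM unitrX ?unitrV //.
by apply: unit_star_denom; exact: prog_gt0.
Qed.
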